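(* Let $G$ be a group and $n\geq 0$ an integer. Then $G$ is a nilpotent group of class $n$ if and only if its coset monoid $\mathcal{K}(G)$ is a $G$-nilpotent monoid of $G$-nilpotent length $n$; and $G$ is a solvable group of derived length $n$ if and only if $\mathcal{K}(G)$ is a $G$-solvable monoid of $G$-solvable length $n$.
   Context: For a group $G$, the coset monoid $\mathcal{K}(G)$ is the set of all right cosets of all subgroups of $G$ with the operation $Ha*Kb=\langle H,K^{a^{-1}}\rangle ab$, where $K^{a^{-1}}=aKa^{-1}$. It is a factorizable inverse monoid with zero $G$ and identity $\{1\}$; its group of units is (isomorphic to) $G$, its idempotents are exactly the subgroups of $G$. For an inverse monoid $S$ with zero $0$ and identity $1$, let $E$ be its semilattice of idempotents and $\leq$ the natural partial order ($a\leq b$ iff $a=eb$ for some $e\in E$). $S$ is factorizable if $S=EU$, where $U$ is the group of units of $S$. The natural connection is $\theta:E\to L(U)$, $e\theta=\{g\in U: eg=e\}$, where $L(U)$ is the lattice of subgroups of $U$; for $S=\mathcal{K}(G)$ it is a dual (order-reversing) isomorphism from $E$ onto $L(U)\cong L(G)$. For an idempotent $e$, $e^{\upharpoonright}=\{s\in S: e\leq s\}$. An element $c$ of an inverse semigroup $T$ is central in $T$ if $ct=tc$ for all $t\in T$; $Z(T)$ is the set of central elements. For idempotents $e,f$ with $f$ central in $e^{\upharpoonright}$, $F_{e,f}=fe^{\upharpoonright}=\{fs: s\in e^{\upharpoonright}\}$ (so $F_{0,f}=fS$). For a factorizable inverse monoid $S$ whose natural connection is a dual isomorphism from $E$ to a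 sublattice of the subgroup lattice of the group of units, a chain $0=e_0\leq e_1\leq\cdots\leq e_n=1$ of central idempotents of $S$ (of length $n$) is a $G$-nilpotent series (resp. $G$-solvable series) if $F_{e_i,e_{i+1}}\subseteq Z(F_{0,e_{i+1}})$ (resp. $F_{e_i,e_{i+1}}$ is commutative) for all $0\leq i\leq n-1$. $S$ is $G$-nilpotent (resp. $G$-solvable) if it has such a series; the length of a shortest one is the $G$-nilpotent (resp. $G$-solvable) length of $S$. (The prefix ''$G$-'' is part of the name of these notions.) *)

(* Defs.v *)
From HB Require Import structures.
From mathcomp Require Import all_boot.
From mathcomp Require Import boolp classical_sets.

Set Implicit Arguments.
Unset Strict Implicit.
Unset Printing Implicit Defensive.

Local Open Scope classical_set_scope.
Local Open Scope group_scope.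

(** * Arbitrary (possibly infinite) groups *)

Section Groups.
Variable G : groupType.
Implicit Types (H K : set G) (a b : G).

Definition subgroup H : Prop :=
  H 1 /\ forall x y, H x -> H y -> H (x * y^-1).

Definition gen (X : set G) : set G := smallest subgroup X.

Definition commutator_subgroup H K : set G :=
  gen [set z | exists x y, [/\ H x, K y & z = [~ x, y]]].

(* Indexed from 0: the k-th term is gamma_(k+1) in the traditional notation. *)
Fixpoint lower_central (k : nat) : set G :=
  if k is k'.+1 then commutator_subgroup (lower_central k') setT else setT.

Fixpoint derived_series (k : nat) : set G :=
  if k is k'.+1 then
    commutator_subgroup (derived_series k') (derived_series k')
  else setT.

Definition nilpotent_of_class (n : nat) : Prop :=
  lower_central n = [set 1] /\
  forall m, lower_central m = [set 1] -> n <= m.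

Definition solvable_of_derived_length (n : nat) : Prop :=
  derived_series n = [set 1] /\
  forall m, derived_series m = [set 1] -> n <= m.

Definition right_coset H a : set G := [set h * a | h in H].

(* H ^ (a^-1) = a H a^-1, since x ^ y = y^-1 * x * y *)
Definition conj_set H a : set G := [set h ^ a | h in H].

Definition is_right_coset (A : set G) : Prop :=
  exists H a, subgroup H /\ A = right_coset H a.

End Groups.

(** * Factorizable inverse monoids *)

Section Monoids.
Variable S : monoidType.
Implicit Types (e f s t u : S) (T V : set S).

Definition idem e : Prop := e * e = e.

Definition natural_le s t : Prop := exists2 e, idem e & s = e * t.

Definition up e : set S := [set s | natural_le e s].

Definition center T : set S :=
  [set c | T c /\ forall t, T t -> c * t = t * c].

Definition commutative_set T : Prop :=
  forall s t, T s -> T t -> s * t = t * s.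

Definition Fset e f : set S := [set f * s | s in up e].

Definition is_inverse s t : Prop := s * t * s = s /\ t * s * t = t.

Definition units : set S := [set u | exists v, u * v = 1 /\ v * u = 1].

Definition connection e : set S := [set g | units g /\ e * g = e].

Definition unit_subgroup V : Prop :=
  [/\ V `<=` units, V 1, forall u v, V u -> V v -> V (u * v) &
      forall u v, V u -> u * v = 1 -> v * u = 1 -> V v].

End Monoids.

(* Factorizable inverse monoids with zero whose natural connection is a dual
   isomorphism from the semilattice of idempotents to a sublattice of the
   lattice of subgroups of the group of units: the connection is an
   order-reversing embedding, and its image is closed under the meet and the
   join of that lattice. *)
HB.mixin Record Monoid_isDualFactorizable S of Monoid S := {
  mzero : S;
  mul0m : forall s : S, mzero * s = mzero;
  mulm0 : forall s : S, s * mzero = mzero;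
  inverseE : forall s : S, exists! t, is_inverse s t;
  factorizableE : forall s : S, exists e u, [/\ idem e, units u & s = e * u];
  connection_subgroup : forall e : S, idem e -> unit_subgroup (connection e);
  connection_le : forall e f : S, idem e -> idem f ->
    natural_le e f <-> connection f `<=` connection e;
  connection_meet : forall e f : S, idem e -> idem f ->
    exists2 g : S, idem g & connection g = connection e `&` connection f;
  connection_join : forall e f : S, idem e -> idem f ->
    exists2 g : S, idem g &
      connection g = smallest (@unit_subgroup S) (connection e `|` connection f)
}.

#[short(type="dualFactorizableType")]
HB.structure Definition DualFactorizable :=
  { S of Monoid_isDualFactorizable S & Monoid S }.

Section Series.
Variable S : dualFactorizableType.

(* Only the values e 0, ..., e n are constrained. *)
Definition central_chain (n : nat) (e : nat -> S) : Prop :=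
  [/\ e 0 = mzero, e n = 1,
      forall i, i <= n -> idem (e i) /\ center setT (e i) &
      forall i, i < n -> natural_le (e i) (e i.+1)].

Definition G_nilpotent_series (n : nat) (e : nat -> S) : Prop :=
  central_chain n e /\
  forall i, i < n -> Fset (e i) (e i.+1) `<=` center (Fset mzero (e i.+1)).

Definition G_solvable_series (n : nat) (e : nat -> S) : Prop :=
  central_chain n e /\
  forall i, i < n -> commutative_set (Fset (e i) (e i.+1)).

Definition G_nilpotent : Prop := exists n e, G_nilpotent_series n e.

Definition G_solvable : Prop := exists n e, G_solvable_series n e.

Definition G_nilpotent_length (n : nat) : Prop :=
  (exists e, G_nilpotent_series n e) /\
  forall m e, G_nilpotent_series m e -> n <= m.

Definition G_solvable_length (n : nat) : Prop :=
  (exists e, G_solvable_series n e) /\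
  forall m e, G_solvable_series m e -> n <= m.

End Series.

(** * The coset monoid *)

Section SubgroupTheory.
Variable G : groupType.
Implicit Types (H K L X Y : set G) (a b : G).

Lemma sub1 H : subgroup H -> H 1. Proof. by case. Qed.

Lemma subV H x : subgroup H -> H x -> H x^-1.
Proof. by move=> [H1 HF] Hx; rewrite -[x^-1]mul1g; exact: HF. Qed.

Lemma subM H x y : subgroup H -> H x -> H y -> H (x * y).
Proof. by move=> sH Hx /(subV sH) Hy; rewrite -[y]invgK; apply sH.2. Qed.

Lemma subgroupP H : H 1 -> (forall x y, H x -> H y -> H (x * y)) ->
  (forall x, H x -> H x^-1) -> subgroup H.
Proof. by move=> H1 HM HV; split=> // x y Hx /HV; exact: HM. Qed.

Lemma gen_subgroup X : subgroup (gen X).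
Proof.
split=> [H [sH _]|x y Xx Xy H HX]; first exact: sub1.
by apply HX.1.2; [exact: Xx | exact: Xy].
Qed.

Lemma sub_gen X : X `<=` gen X.
Proof. by move=> x Xx H [_]; apply. Qed.

Lemma gen_sub X H : subgroup H -> X `<=` H -> gen X `<=` H.
Proof. by move=> sH XH x; apply. Qed.

Lemma gen_id H : subgroup H -> gen H = H.
Proof. by move=> sH; apply/seteqP; split; [exact: gen_sub | exact: sub_gen]. Qed.

Lemma subgroup_setT : subgroup (@setT G). Proof. by []. Qed.

Lemma subgroup_set1 : subgroup ([set 1] : set G).
Proof. by split=> // x y -> ->; rewrite mulgV. Qed.

Lemma conj_subgroup H a : subgroup H -> subgroup (conj_set H a).
Proof.
move=> sH; split; first by exists 1; [exact: sub1 | rewrite conj1g].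
move=> _ _ [x Hx <-] [y Hy <-]; exists (x * y^-1); first by apply sH.2.
by rewrite conjMg conjVg.
Qed.

Lemma conj_setE H a x : conj_set H a x <-> H (x ^ a^-1).
Proof.
split=> [[y Hy <-]|Hx]; first by rewrite conjgK.
by exists (x ^ a^-1) => //; rewrite conjgKV.
Qed.

Lemma gen_conj X a : conj_set (gen X) a = gen (conj_set X a).
Proof.
apply/seteqP; split; last first.
  apply: gen_sub; first exact/conj_subgroup/gen_subgroup.
  by move=> _ [x Xx <-]; exists x => //; exact: sub_gen.
move=> _ [x Xx <-]; have : conj_set (gen (conj_set X a)) a^-1 x.
  apply: Xx; split; first exact/conj_subgroup/gen_subgroup.
  move=> y Xy; apply/conj_setE; rewrite invgK.
  by apply: sub_gen; exists y.
by move/conj_setE; rewrite invgK.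
Qed.

Lemma right_cosetE H a x : right_coset H a x <-> H (x * a^-1).
Proof.
split=> [[y Hy <-]|Hx]; first by rewrite mulgK.
by exists (x * a^-1) => //; rewrite mulgVK.
Qed.

Lemma eq_right_coset H a b : subgroup H -> H (a * b^-1) ->
  right_coset H a = right_coset H b.
Proof.
move=> sH Hab; apply/seteqP; split=> x /right_cosetE Hx; apply/right_cosetE.
  have -> : x * b^-1 = (x * a^-1) * (a * b^-1) by rewrite mulgA mulgVK.
  exact: subM.
have -> : x * a^-1 = (x * b^-1) * (a * b^-1)^-1.
  by rewrite invgF mulgA mulgVK.
by apply sH.2.
Qed.

(* The subgroup of which a right coset A is a coset, and a representative. *)
Definition coset_subgroup (A : set G) : set G :=
  [set z | exists x y, [/\ A x, A y & z = x * y^-1]].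

Definition coset_repr (A : set G) : G := xget 1 A.

(* Ha * Kb = <H, K^(a^-1)> ab; see coset_opE for the independence of the
   representatives. *)
Definition coset_op (A B : set G) : set G :=
  let a := coset_repr A in
  let b := coset_repr B in
  right_coset (gen (coset_subgroup A `|` conj_set (coset_subgroup B) a^-1))
              (a * b).

Lemma coset_subgroupE H a : subgroup H -> coset_subgroup (right_coset H a) = H.
Proof.
move=> sH; apply/seteqP; split=> [_ [_ [_ [[x Hx <-] [y Hy <-] ->]]]|x Hx].
  by rewrite mulgKA; apply sH.2.
exists (x * a), a; split; rewrite ?mulgK //; first by exists x.
by exists 1; [exact: sub1 | rewrite mul1g].
Qed.

Lemma coset_reprP H a : subgroup H ->
  exists2 h, H h & coset_repr (right_coset H a) = h * a.
Proof.
move=> sH; rewrite /coset_repr; case: xgetP => [_ -> [h Hh <-]|no].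
  by exists h.
by case: (no a); exists 1; [exact: sub1 | rewrite mul1g].
Qed.

Lemma coset_opE H K a b : subgroup H -> subgroup K ->
  coset_op (right_coset H a) (right_coset K b) =
  right_coset (gen (H `|` conj_set K a^-1)) (a * b).
Proof.
move=> sH sK; rewrite /coset_op !coset_subgroupE //.
have [h Hh ->] := coset_reprP a sH; have [k Kk ->] := coset_reprP b sK.
have <- : gen (H `|` conj_set K a^-1) = gen (H `|` conj_set K (h * a)^-1).
  have main h1 a1 : H h1 ->
      gen (H `|` conj_set K (h1 * a1)^-1) `<=` gen (H `|` conj_set K a1^-1).
    move=> Hh1; have sL := gen_subgroup (H `|` conj_set K a1^-1).
    apply: gen_sub => // x [Hx|/conj_setE]; first by apply: sub_gen; left.
    rewrite invgK conjgM => Kx.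
    have Lh : gen (H `|` conj_set K a1^-1) h1 by apply: sub_gen; left.
    have Lx : gen (H `|` conj_set K a1^-1) (x ^ h1).
      by apply: sub_gen; right; apply/conj_setE; rewrite invgK.
    rewrite -[x](conjgK h1) conjgE invgK.
    by apply: (subM sL) => //; apply: (subM sL) => //; exact: (subV sL).
  apply/seteqP; split; last exact: main.
  by rewrite -{1}[a](mulKg h); apply: main; exact: (subV sH).
set L := gen _; have sL : subgroup L by exact: gen_subgroup.
apply: eq_right_coset => //.
have -> : h * a * (k * b) * (a * b)^-1 = h * k ^ a^-1.
  by rewrite invgM conjgE invgK !mulgA mulgK.
apply: (subM sL); apply: sub_gen; [by left | right].
by exists k.
Qed.

Lemma is_right_coset_op A B :
  is_right_coset A -> is_right_coset B -> is_right_coset (coset_op A B).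
Proof.
move=> [H [a [sH ->]]] [K [b [sK ->]]]; rewrite coset_opE //.
by do 2!eexists; split; last reflexivity; exact: gen_subgroup.
Qed.

End SubgroupTheory.

Record coset_monoid (G : groupType) :=
  Coset { coset_set : set G; coset_setP : is_right_coset coset_set }.

HB.instance Definition _ (G : groupType) := gen_eqMixin (coset_monoid G).
HB.instance Definition _ (G : groupType) := gen_choiceMixin (coset_monoid G).

Section CosetMonoid.
Variable G : groupType.
Notation KG := (coset_monoid G).
Implicit Types (A B C : KG) (H K L : set G) (a b c : G).

Lemma coset_inj A B : coset_set A = coset_set B -> A = B.
Proof.
case: A B => A cA [B cB] /= eqAB; case: B / eqAB cB => cB.
by congr Coset; exact: Prop_irrelevance.
Qed.

Lemma is_right_coset_right_coset H a :
  subgroup H -> is_right_coset (right_coset H a).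
Proof. by move=> sH; exists H, a. Qed.

Definition mk_coset H (sH : subgroup H) a : KG :=
  Coset (is_right_coset_right_coset a sH).

Definition coset_mul A B : KG :=
  Coset (is_right_coset_op (coset_setP A) (coset_setP B)).

Definition coset_one : KG := mk_coset (@subgroup_set1 G) 1.

Lemma mk_cosetP A : exists H (sH : subgroup H) a, A = mk_coset sH a.
Proof.
by have [H [a [sH eA]]] := coset_setP A; exists H, sH, a; exact: coset_inj.
Qed.

Lemma coset_mulE H K (sH : subgroup H) (sK : subgroup K) a b :
  coset_mul (mk_coset sH a) (mk_coset sK b) =
  mk_coset (gen_subgroup (H `|` conj_set K a^-1)) (a * b).
Proof. by apply: coset_inj; exact: coset_opE. Qed.

Lemma mk_coset_eq H K (sH : subgroup H) (sK : subgroup K) a b :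
  H = K -> K (a * b^-1) -> mk_coset sH a = mk_coset sK b.
Proof.
by move=> eHK Kab; apply: coset_inj; subst K; exact: eq_right_coset.
Qed.

Lemma coset_mulA : associative coset_mul.
Proof.
move=> A B C.
have [H [sH [a ->]]] := mk_cosetP A; have [K [sK [b ->]]] := mk_cosetP B.
have [L [sL [c ->]]] := mk_cosetP C; rewrite !coset_mulE.
apply: mk_coset_eq; last first.
  by rewrite (mulgA a b c) mulgV; apply: sub1; exact: gen_subgroup.
set X := gen (_ `|` conj_set (gen _) _); set Y := gen _.
have sX : subgroup X by exact: gen_subgroup.
have sY : subgroup Y by exact: gen_subgroup.
apply/seteqP; split.
  apply: gen_sub => // x [Hx|]; first by do 2!(apply: sub_gen; left).
  rewrite gen_conj; move: x; apply: gen_sub => // _ [x [Kx|[y Ly <-]] <-].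
    by apply: sub_gen; left; apply: sub_gen; right; exists x.
  by apply: sub_gen; right; exists y; rewrite // invgM conjgM.
apply: gen_sub => // x [|[y Ly <-]]; last first.
  apply: sub_gen; right; rewrite invgM conjgM; exists (y ^ b^-1) => //.
  by apply: sub_gen; right; exists y.
move: x; apply: gen_sub => // x [Hx|[y Ky <-]]; first by apply: sub_gen; left.
by apply: sub_gen; right; exists y => //; apply: sub_gen; left.
Qed.

Lemma coset_mul1 : left_id coset_one coset_mul.
Proof.
move=> A; have [H [sH [a ->]]] := mk_cosetP A; rewrite coset_mulE.
apply: mk_coset_eq; last by rewrite mul1g mulgV; exact: sub1.
apply/seteqP; split.
  apply: gen_sub => // x [->|[y Hy <-]]; first exact: sub1.
  by rewrite invg1 conjg1.
by move=> x Hx; apply: sub_gen; right; exists x; rewrite // invg1 conjg1.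
Qed.

Lemma coset_1mul : right_id coset_one coset_mul.
Proof.
move=> A; have [H [sH [a ->]]] := mk_cosetP A; rewrite coset_mulE.
apply: mk_coset_eq; last by rewrite mulg1 mulgV; exact: sub1.
apply/seteqP; split; last by move=> x Hx; apply: sub_gen; left.
apply: gen_sub => // x [//|[_ -> <-]]; rewrite conj1g; exact: sub1.
Qed.

HB.instance Definition _ :=
  isMonoid.Build (coset_monoid G) coset_mulA coset_mul1 coset_1mul.

End CosetMonoid.

Section CosetMonoidStructure.
Variable G : groupType.
Notation KG := (coset_monoid G).
Implicit Types (A B C : KG) (H K L : set G) (a b c : G).

Lemma mulcE H K (sH : subgroup H) (sK : subgroup K) a b :
  mk_coset sH a * mk_coset sK b =
  mk_coset (gen_subgroup (H `|` conj_set K a^-1)) (a * b) :> KG.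
Proof. exact: coset_mulE. Qed.

Lemma mk_coset_inj H K (sH : subgroup H) (sK : subgroup K) a b :
  mk_coset sH a = mk_coset sK b -> H = K /\ K (a * b^-1).
Proof.
move/(congr1 (@coset_set G)) => /= eHK; split.
  by rewrite -(coset_subgroupE a sH) eHK coset_subgroupE.
apply/right_cosetE; rewrite -eHK; apply/right_cosetE; rewrite mulgV.
exact: sub1.
Qed.

Definition mk_sub H (sH : subgroup H) : KG := mk_coset sH 1.
Definition mk_unit a : KG := mk_coset (@subgroup_set1 G) a.

Lemma mk_sub_mul H K (sH : subgroup H) (sK : subgroup K) :
  mk_sub sH * mk_sub sK = mk_sub (gen_subgroup (H `|` K)).
Proof.
rewrite mulcE; apply: mk_coset_eq; rewrite ?mulg1 ?invg1 ?mulg1.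
  by congr (gen (_ `|` _)); apply/seteqP; split=> [x /conj_setE|x Kx];
    [|apply/conj_setE]; rewrite invg1 conjg1.
apply: sub1; exact: gen_subgroup.
Qed.

Lemma idem_mk_sub H (sH : subgroup H) : idem (mk_sub sH).
Proof.
rewrite /idem mk_sub_mul; apply: mk_coset_eq; rewrite ?setUid ?gen_id //.
by rewrite mulgV; exact: sub1.
Qed.

Lemma idemP A : idem A -> exists H (sH : subgroup H), A = mk_sub sH.
Proof.
have [H [sH [a ->]]] := mk_cosetP A; rewrite /idem mulcE.
move=> /mk_coset_inj [_]; rewrite mulgK => Ha; exists H, sH.
by apply: mk_coset_eq; rewrite ?divg1.
Qed.

Lemma mk_sub_unit H (sH : subgroup H) a : mk_sub sH * mk_unit a = mk_coset sH a.
Proof.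
rewrite mulcE; apply: mk_coset_eq; rewrite ?mul1g ?mulgV; last exact: sub1.
apply/seteqP; split; last by move=> x Hx; apply: sub_gen; left.
by apply: gen_sub => // x [//|[_ -> <-]]; rewrite conj1g; exact: sub1.
Qed.

Lemma mk_unitM a b : mk_unit a * mk_unit b = mk_unit (a * b).
Proof.
rewrite mulcE; apply: mk_coset_eq; rewrite ?mulgV //.
apply/seteqP; split; last by move=> x Hx; apply: sub_gen; left.
by apply: gen_sub (@subgroup_set1 G) _ => x [//|[_ -> <-]]; rewrite conj1g.
Qed.

Lemma mk_unit1 : mk_unit 1 = 1. Proof. by []. Qed.

Lemma units_mk_unit a : units (mk_unit a).
Proof. by exists (mk_unit a^-1); rewrite !mk_unitM mulgV mulVg. Qed.

Lemma unitsP A : units A -> exists a, A = mk_unit a.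
Proof.
move=> [B [AB _]]; move: AB.
have [H [sH [a ->]]] := mk_cosetP A; have [K [sK [b ->]]] := mk_cosetP B.
rewrite mulcE => /mk_coset_inj [eH _]; exists a; apply: mk_coset_eq.
  apply/seteqP; split=> [x Hx|_ ->]; last exact: sub1.
  by rewrite -eH; apply: sub_gen; left.
by rewrite mulgV.
Qed.

Lemma connectionE H (sH : subgroup H) :
  connection (mk_sub sH) = [set mk_unit a | a in H].
Proof.
apply/seteqP; split=> [A [/unitsP [a ->]]|_ [a Ha <-]].
  rewrite mk_sub_unit => /mk_coset_inj [_]; rewrite divg1 => Ha; by exists a.
split; first exact: units_mk_unit.
by rewrite mk_sub_unit; apply: mk_coset_eq; rewrite ?divg1.
Qed.

Lemma mk_unit_inj a b : mk_unit a = mk_unit b -> a = b.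
Proof. by move/mk_coset_inj => [_ /divg1_eq]. Qed.

Lemma mem_connection H (sH : subgroup H) a :
  connection (mk_sub sH) (mk_unit a) <-> H a.
Proof.
rewrite connectionE; split=> [[b Hb /mk_unit_inj <-] //|Ha]; by exists a.
Qed.

Lemma natural_leE H K (sH : subgroup H) (sK : subgroup K) :
  natural_le (mk_sub sH) (mk_sub sK) <-> K `<=` H.
Proof.
split=> [[_ /idemP [L [sL ->]]]|KH].
  rewrite mk_sub_mul => /mk_coset_inj [-> _] x Kx.
  by apply: sub_gen; right.
exists (mk_sub sH); first exact: idem_mk_sub.
rewrite mk_sub_mul; apply: mk_coset_eq; last first.
  by rewrite mulgV; apply: sub1; exact: gen_subgroup.
apply/seteqP; split=> [x Hx|]; first by apply: sub_gen; left.
by apply: gen_sub => // x [//|/KH].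
Qed.

Lemma idemC A B : idem A -> idem B -> A * B = B * A.
Proof.
move=> /idemP [H [sH ->]] /idemP [K [sK ->]]; rewrite !mk_sub_mul.
by apply: mk_coset_eq; rewrite 1?setUC ?mulgV //; apply: sub1; exact: gen_subgroup.
Qed.

Lemma cinverse A : exists! B, is_inverse A B.
Proof.
have uniq_inv B C : is_inverse A B -> is_inverse A C -> B = C.
  move=> [ABA BAB] [ACA CAC].
  have iBA : idem (B * A) by rewrite /idem mulgA BAB.
  have iCA : idem (C * A) by rewrite /idem mulgA CAC.
  have iAB : idem (A * B) by rewrite /idem mulgA ABA.
  have iAC : idem (A * C) by rewrite /idem mulgA ACA.
  have -> : B = C * A * B.
    rewrite -{1}BAB -{1}ACA !mulgA -(mulgA (B * A) C A) (idemC iBA iCA).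
    by rewrite -!mulgA; congr (_ * (_ * _)); rewrite mulgA BAB.
  rewrite -{2}CAC -{2}ABA !mulgA -(mulgA C A B) -(mulgA _ A C).
  by rewrite -(mulgA C (A * B)) (idemC iAB iAC) !mulgA CAC.
have [H [sH [a eA]]] := mk_cosetP A.
pose B := mk_unit a^-1 * mk_sub sH; exists B.
suff iB : is_inverse A B by split=> // C; exact: uniq_inv.
have eA' : A = mk_sub sH * mk_unit a by rewrite eA mk_sub_unit.
have aV : mk_unit a * mk_unit a^-1 = 1 by rewrite mk_unitM mulgV.
have iH := idem_mk_sub sH; rewrite /idem in iH.
have AB : A * B = mk_sub sH by rewrite eA' /B mulgA -(mulgA _ _ (mk_unit _)) aV mulg1.
by split; [rewrite AB eA' mulgA iH | rewrite -mulgA AB /B -mulgA iH].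
Qed.

Definition coset_zero : KG := mk_sub (@subgroup_setT G).

Lemma czero_mul A : coset_zero * A = coset_zero.
Proof.
have [H [sH [a ->]]] := mk_cosetP A; rewrite mulcE; apply: mk_coset_eq => //.
by apply/seteqP; split=> // x _; apply: sub_gen; left.
Qed.

Lemma cmul_zero A : A * coset_zero = coset_zero.
Proof.
have [H [sH [a ->]]] := mk_cosetP A; rewrite mulcE; apply: mk_coset_eq => //.
apply/seteqP; split=> // x _; apply: sub_gen; right.
exact/conj_setE.
Qed.

Lemma cfactorizable A : exists e u, [/\ idem e, units u & A = e * u].
Proof.
have [H [sH [a ->]]] := mk_cosetP A; exists (mk_sub sH), (mk_unit a).
by split; [exact: idem_mk_sub | exact: units_mk_unit | rewrite mk_sub_unit].
Qed.

Lemma cconnection_subgroup A : idem A -> unit_subgroup (connection A).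
Proof.
move=> /idemP [H [sH ->]]; split; first by move=> u [].
- by rewrite -mk_unit1; apply/mem_connection; exact: sub1.
- rewrite connectionE => _ _ [x Hx <-] [y Hy <-].
  by exists (x * y); rewrite ?mk_unitM //; exact: subM.
- rewrite connectionE => _ v [x Hx <-] xv vx.
  have [y ey] : exists y, v = mk_unit y by apply: unitsP; exists (mk_unit x).
  exists x^-1; first exact: (subV sH).
  rewrite ey mk_unitM in xv; rewrite ey; congr mk_unit.
  by apply: mulg1_eq; apply: mk_unit_inj.
Qed.

Lemma cconnection_le A B : idem A -> idem B ->
  natural_le A B <-> connection B `<=` connection A.
Proof.
move=> /idemP [H [sH ->]] /idemP [K [sK ->]].
split=> [/natural_leE KH|cKH]; last first.
  by apply/natural_leE => x /(mem_connection sK)/cKH/mem_connection.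
by rewrite !connectionE => _ [x /KH Hx <-]; exists x.
Qed.

Lemma subgroupI H K : subgroup H -> subgroup K -> subgroup (H `&` K).
Proof.
move=> sH sK; split; first by split; exact: sub1.
by move=> x y [Hx Kx] [Hy Ky]; split; [apply sH.2 | apply sK.2].
Qed.

Lemma cconnection_meet A B : idem A -> idem B ->
  exists2 C, idem C & connection C = connection A `&` connection B.
Proof.
move=> /idemP [H [sH ->]] /idemP [K [sK ->]].
exists (mk_sub (subgroupI sH sK)); first exact: idem_mk_sub.
apply/seteqP; split.
  by rewrite {1}connectionE => _ [x [Hx Kx] <-]; split; apply/mem_connection.
rewrite {1}connectionE => _ [[x Hx <-] /mem_connection Kx].
exact/mem_connection.
Qed.

Lemma cconnection_join A B : idem A -> idem B ->
  exists2 C, idem C & connection C =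
    smallest (@unit_subgroup KG) (connection A `|` connection B).
Proof.
move=> /idemP [H [sH ->]] /idemP [K [sK ->]].
have sHK := gen_subgroup (H `|` K).
exists (mk_sub sHK); first exact: idem_mk_sub.
apply/seteqP; split; last first.
  move=> A' /(_ (connection (mk_sub sHK))); apply; split.
    exact/cconnection_subgroup/idem_mk_sub.
  by rewrite !connectionE => _ [] [x Hx <-]; exists x => //; apply: sub_gen;
    [left | right].
rewrite (connectionE sHK) => _ [x HKx <-] V [[_ V1 VM VV] HKV].
apply: (HKx [set y | V (mk_unit y)]); split.
  apply: subgroupP => //= [y z|y Vy]; first by rewrite -mk_unitM; exact: VM.
  by apply: (VV _ _ Vy); rewrite mk_unitM ?mulgV ?mulVg.
by move=> y [Hy|Ky]; apply: HKV; [left | right]; apply/mem_connection.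
Qed.

HB.instance Definition _ := Monoid_isDualFactorizable.Build (coset_monoid G)
  czero_mul cmul_zero cinverse cfactorizable cconnection_subgroup
  cconnection_le cconnection_meet cconnection_join.

End CosetMonoidStructure.

(* Main.v *)
(* An idempotent of K(G) is a subgroup of G, it is central exactly when the
   subgroup is normal, and the order on idempotents is reverse inclusion.  The
   elements above H are the cosets L a with L and a inside H, so for N normal
   the elements of F_{H,N} and F_{K,N} commute exactly when [H, K] lies in N.
   Hence a G-nilpotent (resp. G-solvable) series is a descending normal series
   from G to 1 with [N_i, G] (resp. [N_i, N_i]) inside N_{i+1}, and the lower
   central (resp. derived) series is the fastest descending one. *)

Require Import Defs.
From mathcomp Require Import all_boot.
From mathcomp Require Import classical_sets.

Set Implicit Arguments.
Unset Strict Implicit.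
Unset Printing Implicit Defensive.

Local Open Scope classical_set_scope.
Local Open Scope group_scope.

(** * Normality and commutator subgroups in an arbitrary group *)

Section NormalSubgroups.
Variable G : groupType.
Implicit Types (H K N : set G).

Definition normal N : Prop := subgroup N /\ forall x g, N x -> N (x ^ g).

Lemma normal_setT : normal (@setT G). Proof. by split. Qed.

Lemma sub_commutator_subgroup H K N : subgroup N ->
  (forall x y, H x -> K y -> N [~ x, y]) <-> commutator_subgroup H K `<=` N.
Proof.
move=> sN; split=> [HKN|HKN x y Hx Ky].
  by apply: gen_sub => // _ [x [y [Hx Ky ->]]]; exact: HKN.
by apply: HKN; apply: sub_gen; exists x, y.
Qed.

Lemma commutator_subgroupS H H' K K' : H `<=` H' -> K `<=` K' ->
  commutator_subgroup H K `<=` commutator_subgroup H' K'.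
Proof.
move=> HH' KK'; apply/sub_commutator_subgroup; first exact: gen_subgroup.
by move=> x y /HH' Hx /KK' Ky; apply: sub_gen; exists x, y.
Qed.

Lemma commutator_subgroup_subl H K : normal H ->
  commutator_subgroup H K `<=` H.
Proof.
move=> [sH nH]; apply/sub_commutator_subgroup => // x y Hx _.
by rewrite commgEl; apply: subM => //; [exact: subV | exact: nH].
Qed.

(** Conjugation is an automorphism, so it sends a generating commutator to a generating
    commutator. *)
Lemma commutator_subgroup_normal H K : normal H -> normal K ->
  normal (commutator_subgroup H K).
Proof.
move=> [_ nH] [_ nK]; split=> [|x g xHK]; first exact: gen_subgroup.
have : conj_set (commutator_subgroup H K) g (x ^ g) by exists x.
rewrite /commutator_subgroup gen_conj; apply: gen_sub.
  exact: gen_subgroup.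
move=> _ [_ [y [z [Hy Kz ->]]] <-]; apply: sub_gen.
by exists (y ^ g), (z ^ g); split; [exact: nH | exact: nK | rewrite conjRg].
Qed.

End NormalSubgroups.

(** * Central idempotents of the coset monoid and commutation in the sets F_{e,f} *)

Section CosetMonoidSubgroups.
Variable G : groupType.
Notation KG := (coset_monoid G).
Implicit Types (A B : KG) (H K L M N : set G) (a b : G).

Lemma coset_set_mk_sub H (sH : subgroup H) : coset_set (mk_sub sH) = H.
Proof.
by apply/seteqP; split=> x; rewrite /= right_cosetE invg1 mulg1.
Qed.

(** Multiplying by a coset Ha on the left conjugates N by a^-1. Normality removes this twist, and
    both products become the coset of <H, N> through a. *)
Lemma center_mk_sub N (sN : subgroup N) :
  center setT (mk_sub sN) <-> normal N.
Proof.
split=> [[_ cN]|[_ nN]].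
  split=> // x g Nx.
  (* Commuting with the unit g^-1 compares N with N^g. *)
  have := cN (mk_unit g^-1) I.
  rewrite mk_sub_unit mulcE => /mk_coset_inj [-> _].
  by apply: sub_gen; right; apply/conj_setE; rewrite invgK conjgK.
split=> // A _; have [H [sH [a ->]]] := mk_cosetP A.
rewrite !mulcE; apply: mk_coset_eq; last first.
  by rewrite mul1g mulg1 mulgV; apply: sub1; exact: gen_subgroup.
have -> : conj_set N a^-1 = N.
  apply/seteqP; split=> x; rewrite conj_setE invgK => Nx; last exact: nN.
  by rewrite -[x](conjgK a); exact: nN.
suff -> : conj_set H 1^-1 = H by rewrite setUC.
by apply/seteqP; split=> x; rewrite conj_setE !invg1 conjg1.
Qed.

(** If H = F * La with F an idempotent, then H is generated by F and L, and H as a coset of itself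
    has both 1 and a as representatives. *)
Lemma up_mk_sub H (sH : subgroup H) A :
  up (mk_sub sH) A ->
  exists L (sL : subgroup L) a, [/\ L `<=` H, H a & A = mk_coset sL a].
Proof.
have [L [sL [a ->]]] := mk_cosetP A => -[_ /idemP [F [sF ->]]].
rewrite mulcE => /mk_coset_inj [-> Ha]; exists L, sL, a; split=> //.
  move=> x Lx; apply: sub_gen; right; apply/conj_setE.
  by rewrite !invg1 conjg1.
have {Ha} := subV (gen_subgroup _) Ha.
by rewrite !mul1g invgK.
Qed.

Lemma up_mk_unit H (sH : subgroup H) a : H a -> up (mk_sub sH) (mk_unit a).
Proof.
move=> Ha; exists (mk_sub sH); first exact: idem_mk_sub.
rewrite mk_sub_unit; apply: mk_coset_eq => //.
by rewrite mul1g; exact: subV.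
Qed.

(** Modulo N, elements of H and K centralize each other, so the conjugations in the two products do
    not change the subgroup generated together with N. The representatives ab and ba differ by a
    commutator. *)
Lemma mk_sub_mul_commute H K N L M (sN : subgroup N) (sL : subgroup L)
    (sM : subgroup M) a b :
  commutator_subgroup H K `<=` N -> L `<=` H -> M `<=` K -> H a -> K b ->
  subgroup H -> subgroup K ->
  mk_sub sN * (mk_coset sL a * mk_coset sM b) =
  mk_sub sN * (mk_coset sM b * mk_coset sL a).
Proof.
move=> /(sub_commutator_subgroup _ _ sN).
(* All data are generalized because the reverse inclusion is the same claim with the roles of H and
   K exchanged. *)
have half H' K' L' M' a' b' : (forall x y, H' x -> K' y -> N [~ x, y]) ->
    L' `<=` H' -> M' `<=` K' -> H' a' -> K' b' -> subgroup H' -> subgroup K' ->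
    gen (N `|` conj_set (gen (L' `|` conj_set M' a'^-1)) 1^-1) `<=`
    gen (N `|` conj_set (gen (M' `|` conj_set L' b'^-1)) 1^-1).
  move=> HKN LH MK Ha Kb sH sK; set Y := (Y in _ `<=` Y).
  have sY : subgroup Y by exact: gen_subgroup.
  have NY x : N x -> Y x by move=> Nx; apply: sub_gen; left.
  have MY x : M' x -> Y x.
    move=> Mx; apply: sub_gen; right; apply/conj_setE; rewrite !invg1 conjg1.
    by apply: sub_gen; left.
  have LY x : L' x -> Y (x ^ b'^-1).
    move=> Lx; apply: sub_gen; right; apply/conj_setE; rewrite !invg1 conjg1.
    by apply: sub_gen; right; exists x.
  apply: gen_sub => // x [/NY //|/conj_setE]; rewrite !invg1 conjg1.
  move: x; apply: gen_sub => // x [Lx|[y My <-]].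
    (* The conjugate of x is available in [Y], and the correction is a commutator, hence in N. *)
    have -> : x = x ^ b'^-1 * [~ x, b'^-1]^-1.
      by rewrite commgEl invgM invgK mulVKg.
    apply: (subM sY); first exact: LY.
    by apply: (subV sY); apply: NY; apply: HKN; [exact: LH | exact: subV].
  have -> : y ^ a'^-1 = y * [~ a'^-1, y]^-1.
    by rewrite invgR commgEl mulVKg.
  apply: (subM sY); first exact: MY.
  by apply: (subV sY); apply: NY; apply: HKN; [exact: subV | exact: MK].
move=> HKN LH MK Ha Kb sH sK.
have KHN x y : K x -> H y -> N [~ x, y].
  by move=> Kx Hy; rewrite -invgR; apply: subV => //; exact: HKN.
rewrite !mulcE; apply: mk_coset_eq.
  apply/seteqP; split.
    exact: (half H K).
  exact: (half K H).
rewrite !mul1g; apply: sub_gen; left.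
have -> : a * b * (b * a)^-1 = [~ a^-1, b^-1].
  by rewrite (commgCV a b) mulgK.
by apply: HKN; exact: subV.
Qed.

(** As N is a central idempotent, Ns * Nt = N(st). So only products of elements above H and K, cut
    down by N, need comparing; units from H and K already detect every commutator. *)
Lemma Fset_commute H K N (sH : subgroup H) (sK : subgroup K)
    (sN : subgroup N) : normal N ->
  (forall A B, Fset (mk_sub sH) (mk_sub sN) A ->
     Fset (mk_sub sK) (mk_sub sN) B -> A * B = B * A) <->
  commutator_subgroup H K `<=` N.
Proof.
move=> /(center_mk_sub sN) [_ cN].
have NN s t : mk_sub sN * s * (mk_sub sN * t) = mk_sub sN * (s * t).
  rewrite (cN s) // -mulgA (mulgA (mk_sub sN)) (idem_mk_sub sN) !mulgA.
  by rewrite -(cN s).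
split=> [comm|HKN].
  apply/(sub_commutator_subgroup _ _ sN) => a b Ha Kb.
  (* Inverses are taken because the quotient of xy by yx is [x^-1, y^-1]. *)
  have Fa : Fset (mk_sub sH) (mk_sub sN) (mk_sub sN * mk_unit a^-1).
    by exists (mk_unit a^-1) => //; apply: up_mk_unit; exact: subV.
  have Fb : Fset (mk_sub sK) (mk_sub sN) (mk_sub sN * mk_unit b^-1).
    by exists (mk_unit b^-1) => //; apply: up_mk_unit; exact: subV.
  have := comm _ _ Fa Fb; rewrite !NN !mk_unitM !mk_sub_unit.
  by move=> /mk_coset_inj [_]; rewrite (commgCV a^-1) mulgK !invgK.
move=> A B [_ /up_mk_sub [L [sL [a [LH Ha ->]]]] <-].
move=> [_ /up_mk_sub [M [sM [b [MK Kb ->]]]] <-].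
by rewrite !NN; exact: (mk_sub_mul_commute (H := H) (K := K)).
Qed.

(** Membership in [center T] includes membership in T, so a G-nilpotent series also needs F_{H,N}
    inside F_{0,N}: the case K = G. *)
Lemma FsetS H K N (sH : subgroup H) (sK : subgroup K) (sN : subgroup N) :
  H `<=` K -> Fset (mk_sub sH) (mk_sub sN) `<=` Fset (mk_sub sK) (mk_sub sN).
Proof.
move=> HK _ [_ /up_mk_sub [L [sL [a [LH Ha ->]]]] <-].
exists (mk_coset sL a) => //; exists (mk_sub sK); first exact: idem_mk_sub.
rewrite mulcE; apply: mk_coset_eq; last first.
  rewrite !mul1g; apply: (subV (gen_subgroup _)).
  by apply: sub_gen; left; exact: HK.
apply/seteqP; split=> [x Kx|]; first by apply: sub_gen; left.
by apply: gen_sub => // x [//|/conj_setE]; rewrite !invg1 conjg1 => /LH/HK.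
Qed.

End CosetMonoidSubgroups.

(* The lower central series is the case D H = G, the derived series the case
   D H = H. *)
Section CommutatorSeries.
Variables (G : groupType) (D : set G -> set G).
Hypothesis D_normal : forall H, normal H -> normal (D H).
Hypothesis D_mono : forall H K, H `<=` K -> D H `<=` D K.

Fixpoint commutator_series (k : nat) : set G :=
  if k is k'.+1 then
    commutator_subgroup (commutator_series k') (D (commutator_series k'))
  else setT.

Lemma commutator_series_normal k : normal (commutator_series k).
Proof.
elim: k => [|k IHk]; first exact: normal_setT.
by apply: commutator_subgroup_normal => //; exact: D_normal.
Qed.

Lemma commutator_series_eq1 n :
  commutator_series n = [set 1] <->
  exists e : nat -> coset_monoid G, central_chain n e /\
    forall i, i < n ->
      commutator_subgroup (coset_set (e i)) (D (coset_set (e i)))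
        `<=` coset_set (e i.+1).
Proof.
split=> [sn1|[e [[e0 en ec _] eD]]].
  pose s i := (commutator_series_normal i).1.
  exists (fun i => mk_sub (s i)); split; last first.
    by move=> i _; rewrite !coset_set_mk_sub.
  split.
  - by apply: mk_coset_eq; rewrite ?mulgV.
  - by apply: mk_coset_eq; rewrite ?mulgV.
  - move=> i _; split; first exact: idem_mk_sub.
    exact/center_mk_sub/commutator_series_normal.
  - move=> i _; apply/natural_leE; apply: commutator_subgroup_subl.
    exact: commutator_series_normal.
(* Any such chain contains the commutator series term by term, since commutators and [D] are
   monotone. *)
have se i : i <= n -> commutator_series i `<=` coset_set (e i).
  elim: i => [_|i IHi lt_in]; first by rewrite e0 coset_set_mk_sub.
  apply: subset_trans (eD i lt_in).
  by apply: commutator_subgroupS; [|apply: D_mono]; apply: IHi; exact: ltnW.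
apply/seteqP; split=> [x /(se n (leqnn n))|_ ->].
  by rewrite en (coset_set_mk_sub (@subgroup_set1 G)).
exact: sub1 (commutator_series_normal n).1.
Qed.

End CommutatorSeries.

(** * From commutator series to G-nilpotent and G-solvable series *)

Section Series.
Variable G : groupType.

Lemma central_chain_step n (e : nat -> coset_monoid G) i :
  central_chain n e -> i < n ->
  exists H (sH : subgroup H) N (sN : subgroup N),
    [/\ e i = mk_sub sH, e i.+1 = mk_sub sN & normal N].
Proof.
move=> [_ _ ec _] lt_in.
have [/idemP [H [sH eH]] _] := ec i (ltnW lt_in).
have [/idemP [N [sN eN]] cN] := ec i.+1 lt_in.
by exists H, sH, N, sN; split=> //; apply/(center_mk_sub sN); rewrite -eN.
Qed.

Lemma lower_central_eq1 n :
  lower_central n = [set 1 : G] <->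
  exists e : nat -> coset_monoid G, G_nilpotent_series n e.
Proof.
(* For this [D] the generic series is convertible to [lower_central]. *)
apply: (iff_trans (commutator_series_eq1 (D := fun=> setT) _ _ n)) => //.
split=> -[e [ce eD]]; exists e; split=> // i lt_in;
  move: (eD i lt_in);
  have [H [sH [N [sN [-> -> nN]]]]] := central_chain_step ce lt_in;
  rewrite !coset_set_mk_sub.
  move=> /(Fset_commute sH (@subgroup_setT G) sN nN) comm A FA.
  by split=> [|B FB]; [exact: FsetS FA | exact: comm].
move=> FZ; apply/(Fset_commute sH (@subgroup_setT G) sN nN) => A B FA FB.
exact: (FZ A FA).2.
Qed.

Lemma derived_series_eq1 n :
  derived_series n = [set 1 : G] <->
  exists e : nat -> coset_monoid G, G_solvable_series n e.
Proof.
apply: (iff_trans (commutator_series_eq1 (D := id) _ _ n)) => //.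
split=> -[e [ce eD]]; exists e; split=> // i lt_in;
  move: (eD i lt_in);
  have [H [sH [N [sN [-> -> nN]]]]] := central_chain_step ce lt_in;
  rewrite !coset_set_mk_sub.
  exact: (Fset_commute sH sH sN nN).2.
exact: (Fset_commute sH sH sN nN).1.
Qed.

End Series.

Theorem corollary3p8 (G : groupType) (n : nat) :
  (nilpotent_of_class G n <->
     G_nilpotent (coset_monoid G) /\ G_nilpotent_length (coset_monoid G) n) /\
  (solvable_of_derived_length G n <->
     G_solvable (coset_monoid G) /\ G_solvable_length (coset_monoid G) n).
Proof.
(* Each equivalence holds at every length, so minimality transfers along with existence. *)
split; split.
- move=> [/lower_central_eq1 sn minn]; split; first by exists n.
  by split=> // m e em; apply/minn/lower_central_eq1; exists e.
- move=> [_ [/lower_central_eq1 sn minn]].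
  by split=> // m /lower_central_eq1 [e]; exact: minn.
- move=> [/derived_series_eq1 sn minn]; split; first by exists n.
  by split=> // m e em; apply/minn/derived_series_eq1; exists e.
- move=> [_ [/derived_series_eq1 sn minn]].
  by split=> // m /derived_series_eq1 [e]; exact: minn.
Qed.
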